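(* For any integer $d \ge 2$, put $$e_d:=\frac{2^d-\lceil \log_2 (d+2) \rceil}{2^d-1}, \qquad e_d':=\frac{2^d-2}{2^d-1}.$$ Then there exist constants $c_d, c_d'>0$ (depending only on $d$) such that for every positive integer $m$ $$c_d\, m^{e_d} \le f(m, B_d\text{-free}) \le c_d'\, m^{e_d'}.$$ In particular, for $d=2$, $$(3\cdot 2^{-7/3}+o(1))\,m^{2/3} \le f(m,B_2\text{-free}) \le \frac{3}{2}\,m^{2/3},$$ where $o(1)$ denotes a quantity tending to $0$ as $m\to\infty$.
   Context: Write $[d]=\{1,2,\dots,d\}$. A family $\mathcal{B}$ of $2^d$ distinct sets forms a Boolean algebra of dimension $d$ if its members can be indexed by the subsets of $[d]$, $\mathcal{B}=\{B_I : I\subseteq [d]\}$, so that $B_I\cap B_J=B_{I\cap J}$ and $B_I\cup B_J=B_{I\cup J}$ for all $I,J\subseteq [d]$. A family of sets is $B_d$-free if it contains no subfamily forming a Boolean algebra of dimension $d$. (For $d=2$: no four distinct sets $F_1,F_2,F_3,F_4$ of the family satisfy $F_1\cup F_2=F_3$ and $F_1\cap F_2=F_4$.) For a property $\Gamma$ of families of sets and a family $\mathcal{F}$ of sets, $f(\mathcal{F},\Gamma)$ is the size of the largest subfamily $\mathcal{F}'\subseteq\mathcal{F}$ having property $\Gamma$. For a positive integer $m$, $f(m,\Gamma):=\min\{f(\mathcal{F},\Gamma): |\mathcal{F}|=m\}$, the minimum being over all families of $m$ distinct sets. *)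

(* Defs.v *)
From HB Require Import structures.
From mathcomp Require Import all_boot all_order all_algebra finmap.
From mathcomp Require Import all_classical all_reals all_analysis.
Set Implicit Arguments.
Unset Strict Implicit.
Unset Printing Implicit Defensive.
Import Order.TTheory GRing.Theory Num.Theory.
Import numFieldNormedType.Exports.
Local Open Scope classical_set_scope.
Local Open Scope ring_scope.

(* The finite families of sets over a ground type [T], which may be infinite. *)
Definition set_family (T : Type) := {fset (set T)}.

Definition family_property := forall T : Type, set_family T -> Prop.

(* The index set [d] = {1, ..., d} is rendered by ['I_d]. *)
Definition boolean_algebra (d : nat) (T : Type) (A : set_family T) : Prop :=
  #|` A| = (2 ^ d)%N /\
  exists B : {set 'I_d} -> set T,
    [/\ forall X : set T, (X \in A) <-> exists I, X = B I,
        forall I J, B I `&` B J = B (I :&: J)%SET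
      & forall I J, B I `|` B J = B (I :|: J)%SET].

Definition Bfree (d : nat) : family_property := fun T F =>
  forall A : set_family T, (A `<=` F)%fset -> ~ boolean_algebra d A.

(* As a maximum over an empty range, it is 0 when no subfamily of [F] has [G];
   [Bfree d] always holds of the empty subfamily. *)
Definition largest_sub (T : Type) (F : set_family T) (G : family_property) : nat :=
  \max_(F' <- fpowerset F | `[< G T F' >]) #|` F'|.

(* [T] ranges over all types of a universe, so the ground set is not bounded. *)
Definition fmin_value (m : nat) (G : family_property) : pred nat := fun k =>
  `[< exists (T : Type) (F : set_family T), #|` F| = m /\ largest_sub F G = k >].

Lemma fmin_value_ex (m : nat) (G : family_property) :
  exists k, fmin_value m G k.
Proof.
pose F : set_family nat := [fset [set i] | i in iota 0 m]%fset.
exists (largest_sub F G); apply/asboolP; exists nat, F; split => //.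
rewrite card_imfset /=; last by move=> i j /seteqP[/(_ i erefl)].
by rewrite undup_id ?size_iota // iota_uniq.
Qed.

Definition fmin (m : nat) (G : family_property) : nat :=
  ex_minn (fmin_value_ex m G).

Definition log2 (R : realType) (x : R) : R := ln x / ln 2.

Definition e_low (R : realType) (d : nat) : R :=
  (2 ^+ d - (Num.ceil (log2 (d%:R + 2 : R)))%:~R) / (2 ^+ d - 1).

Definition e_up (R : realType) (d : nat) : R := (2 ^+ d - 2) / (2 ^+ d - 1).

(* Main.v *)
(* Upper bound: in a product of [d] chains every combinatorial box is a Boolean
   algebra of dimension [d], so a Zarankiewicz-type count applies.  A set [S] of
   more than [|Y| + t * 'C(n, 2)] points of ['I_n * Y] has two levels [x < y]
   over which more than [t] points of [Y] are common; a box among these common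
   points yields a box in [S].

   Lower bound: a Boolean algebra of dimension [d] is determined by
   [k = ceil (log2 (d + 2))] of its members, so a family of size [m] contains at
   most [m ^ k] of them (at most ['C(m, 2)] if [d = 2]).  Keep each member with
   probability [p], then delete one member of each surviving algebra: some
   subfamily of size at least [p * m - p ^ (2 ^ d) * m ^ k] is free of them. *)
Require Import Defs.
From HB Require Import structures.
From mathcomp Require Import all_boot all_order all_algebra finmap.
From mathcomp Require Import all_classical all_reals all_analysis.
From mathcomp Require Import zify ring lra.
Set Implicit Arguments.
Unset Strict Implicit.
Unset Printing Implicit Defensive.
Import Order.TTheory GRing.Theory Num.Theory.
Import numFieldNormedType.Exports.
Local Open Scope classical_set_scope.
Local Open Scope ring_scope.

(** * Random deletion in uniform hypergraphs *)

(** [w f] is the probability of the random set [U f] in which each point is kept independently with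
    probability [p]. By linearity the expectation of [val f] is the left-hand side, so some outcome
    attains it; removing one vertex of each surviving edge costs at most [#|hit f|]. *)
Lemma deletion_method (R : realDomainType) (V : finType) (E : {set {set V}})
    (r : nat) (p : R) :
  (0 < r)%N -> (forall e, e \in E -> #|e| = r) -> 0 <= p -> p <= 1 ->
  exists2 S : {set V}, p * #|V|%:R - p ^+ r * #|E|%:R <= #|S|%:R &
    forall e, e \in E -> ~~ (e \subset S).
Proof.
move=> r0 Er p0 p1.
pose w (f : {ffun V -> bool}) := \prod_v (if f v then p else 1 - p).
pose U (f : {ffun V -> bool}) := [set v | f v]%SET.
pose hit f := [set e in E | e \subset U f]%SET.
pose val f : R := #|U f|%:R - #|hit f|%:R.
have w0 f : 0 <= w f.
  by apply: prodr_ge0 => v _; case: ifP; rewrite // subr_ge0.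
(* The probability that [e] survives. The indicator is absorbed by giving weight 0 to dropping a
   point of [e]; the sum then factors over points, with factor [p] on [e] and [p + (1 - p) = 1]
   elsewhere. *)
have wE (e : {set V}) : \sum_f w f * (e \subset U f)%:R = p ^+ #|e|.
  transitivity (\sum_(f : {ffun V -> bool}) \prod_v
      (if f v then p else if v \in e then 0 else 1 - p)).
    apply: eq_bigr => f _; case: (boolP (e \subset _)) => [ef|].
      rewrite mulr1; apply: eq_bigr => v _; case: ifPn => // fv.
      by case: ifPn => // /(fintype.subsetP ef); rewrite inE (negbTE fv).
    case/fintype.subsetPn => v ve; rewrite inE => fv.
    by rewrite mulr0 (bigD1 v) //= (negbTE fv) ve mul0r.
  rewrite -(bigA_distr_bigA (fun v (b : bool) =>
     if b then p else if v \in e then 0 else 1 - p)).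
  rewrite -prodr_const [RHS]big_mkcond /=; apply: eq_bigr => v _.
  by rewrite big_bool /=; case: ifP => _; ring.
have total : \sum_f w f = 1.
  rewrite -[RHS](expr0 p) -(@cards0 V) -wE; apply: eq_bigr => f _.
  by rewrite finset.sub0set mulr1.
have mean : \sum_f w f * val f = p * #|V|%:R - p ^+ r * #|E|%:R.
  under eq_bigr do rewrite mulrBr.
  rewrite sumrB; congr (_ - _).
    transitivity (\sum_f \sum_v w f * ([set v]%SET \subset U f)%:R).
      apply: eq_bigr => f _; rewrite -mulr_sumr; congr (_ * _).
      rewrite -sum1_card natr_sum big_mkcond; apply: eq_bigr => v _.
      by rewrite finset.sub1set; case: ifP.
    rewrite exchange_big /=; under eq_bigr do rewrite wE cards1 expr1.
    by rewrite sumr_const cardT mulr_natr enumT.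
  transitivity (\sum_f \sum_(e in E) w f * (e \subset U f)%:R).
    apply: eq_bigr => f _; rewrite -mulr_sumr; congr (_ * _).
    rewrite -sum1_card natr_sum big_mkcond [RHS]big_mkcond.
    by apply: eq_bigr => e _; rewrite inE; case: (e \in E); case: (e \subset _).
  rewrite exchange_big /=.
  under eq_bigr => e eE do rewrite wE (Er e eE).
  by rewrite sumr_const mulr_natr.
have [f fval] : exists f, p * #|V|%:R - p ^+ r * #|E|%:R <= val f.
  apply/not_existsP => no.
  have lt f : 0 < p * #|V|%:R - p ^+ r * #|E|%:R - val f.
    by rewrite subr_gt0 ltNge; apply/negP/no.
  have : \sum_f w f * (p * #|V|%:R - p ^+ r * #|E|%:R - val f) = 0.
    under eq_bigr do rewrite mulrBr.
    by rewrite sumrB -mulr_suml total mul1r mean subrr.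
  move/psumr_eq0P => /(_ (fun f _ => mulr_ge0 (w0 f) (ltW (lt f)))) w_eq0.
  suff : \sum_f w f = 0 by rewrite total => /eqP; rewrite oner_eq0.
  apply: big1 => f _; have /eqP := w_eq0 f isT.
  by rewrite mulf_eq0 (gt_eqF (lt f)) orbF => /eqP.
(* [rep e] is [None] only for empty [e], which [0 < r] excludes among edges. [D] collects the chosen
   vertices of the surviving edges. *)
pose rep (e : {set V}) := [pick v in e].
pose D := [set v | Some v \in rep @: hit f]%SET.
exists (U f :\: D)%SET.
  apply: le_trans fval _; rewrite /val lerBlDr -natrD ler_nat.
  have : (#|D| <= #|hit f|)%N.
    apply: leq_trans (leq_imset_card rep (mem (hit f))).
    have Some_inj : injective (@Some V) by move=> u v [].
    rewrite -(card_imset _ Some_inj); apply: subset_leq_card.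
    by apply/fintype.subsetP => _ /imsetP[v vD ->]; rewrite inE in vD.
  rewrite cardsD; have := subset_leq_card (finset.subsetIr (U f) D); lia.
move=> e eE; apply/negP => sub.
have eh : e \in hit f.
  by rewrite inE eE (fintype.subset_trans sub) // finset.subsetDl.
have [v ve]: exists v, v \in e by apply/card_gt0P; rewrite (Er e eE).
have [u ue ru]: exists2 u, u \in e & rep e = Some u.
  by rewrite /rep; case: pickP => [u ue|/(_ v)]; [exists u|rewrite ve].
move/fintype.subsetP: sub => /(_ u ue); rewrite !inE => /andP[/negP[]].
by rewrite -ru imset_f.
Qed.

(** * Boxes in products of chains *)

Definition lattice_hom (d : nat) (T : Type) (B : {set 'I_d} -> set T) : Prop :=
  (forall I J, B I `&` B J = B (I :&: J)%SET) /\
  (forall I J, B I `|` B J = B (I :|: J)%SET).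

(** An extremal threshold for the indexed family [phi]. Quantifying over every [S] lets the
    induction on [d] apply it to the points common to two levels of a new chain. *)
Definition forces_algebra (d : nat) (T : Type) (V : finType) (phi : V -> set T)
    (t : nat) : Prop :=
  forall S : {set V}, (t < #|S|)%N ->
  exists B : {set 'I_d} -> set T,
    [/\ lattice_hom B, injective B & forall I, exists2 v, v \in S & B I = phi v].

(** The product with a chain of [n] sets: level [x] is the initial segment of length [x] in a fresh
    copy of [nat], so intersection and union act on levels as minimum and maximum. *)
Definition with_chain (T : Type) (V : finType) (n : nat) (phi : V -> set T)
    (x : 'I_n * V) : set (T + nat) :=
  fun y => match y with inl t => phi x.2 t | inr k => (k < x.1)%N end.

Lemma with_chain_inj (T : Type) (V : finType) (n : nat) (phi : V -> set T) :
  injective phi -> injective (with_chain (n := n) phi).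
Proof.
move=> inj [i v] [j u] eq_iv; have eq_v : v = u.
  by apply: inj; apply/funext => t; have := congr1 (@^~ (inl t)) eq_iv.
congr pair => //; apply/val_inj/eqP; rewrite eqn_leq /=; apply/andP; split.
  rewrite leqNgt; apply/negP.
  by have /= -> := congr1 (@^~ (inr (nat_of_ord j))) eq_iv; rewrite ltnn.
rewrite leqNgt; apply/negP.
by have /= <- := congr1 (@^~ (inr (nat_of_ord i))) eq_iv; rewrite ltnn.
Qed.

Lemma forces_algebra0 (T : Type) (V : finType) (phi : V -> set T) :
  forces_algebra 0 phi 0.
Proof.
move=> S /card_gt0P[v vS]; exists (fun=> phi v); split.
- by split=> I J; rewrite ?setIid ?setUid.
- by move=> I J _; apply/setP => -[].
- by move=> I; exists v.
Qed.

(* Double counting: a fibre of size [s] contains ['C(s, 2) >= s - 1] pairs. *)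
Lemma rich_pair (n : nat) (V : finType) (t : nat) (S : {set 'I_n * V}) :
  (#|V| + t * 'C(n, 2) < #|S|)%N ->
  exists x y : 'I_n, (x < y)%N /\
    (t < #|[set v | ((x, v) \in S) && ((y, v) \in S)]%SET|)%N.
Proof.
move=> lt_S; pose fib v := [set x | (x, v) \in S]%SET.
pose P := [set e : {set 'I_n} | #|e| == 2]%SET.
pose common (e : {set 'I_n}) := [set v | e \subset fib v]%SET.
have cardS : #|S| = (\sum_v #|fib v|)%N.
  under [RHS]eq_bigr do rewrite -sum1_card big_mkcond.
  rewrite -sum1_card big_mkcond exchange_big pair_bigA /=.
  by apply: eq_bigr => -[x v] _; rewrite inE.
have le_bin k : (k <= 1 + 'C(k, 2))%N.
  by case: k => [|[|k]] //; rewrite !binS bin0 bin1; lia.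
have count : (\sum_v 'C(#|fib v|, 2) = \sum_(e in P) #|common e|)%N.
  under eq_bigr do rewrite -cards_draws -sum1_card big_mkcond.
  rewrite exchange_big [RHS]big_mkcond; apply: eq_bigr => e _ /=.
  rewrite -sum1_card -big_mkcond inE; case: ifP => e2; last first.
    by rewrite big1 // => v; rewrite inE e2 andbF.
  by apply: eq_bigl => v; rewrite !inE e2 andbT.
(* Otherwise the sum of [1 + 'C(#|fib v|, 2)] over [v], which bounds [#|S|], would be at most
   [#|V| + t * 'C(n, 2)]. *)
have [e eP te] : exists2 e, e \in P & (t < #|common e|)%N.
  apply: contrapT => no; suff : (#|S| <= #|V| + t * 'C(n, 2))%N by rewrite leqNgt lt_S.
  rewrite cardS (leq_trans (leq_sum _ (fun v _ => le_bin _))) //.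
  rewrite big_split /= sum1_card leq_add2l count.
  rewrite -[n in 'C(n, _)]card_ord -card_draws mulnC -sum_nat_const leq_sum // => e eP.
  by rewrite leqNgt; apply/negP => te; apply: no; exists e.
move: eP; rewrite inE => /cards2P[x [y [xy ee]]].
wlog lt_xy : x y xy ee / (x < y)%N => [hw|].
  case: (ltngtP x y) => [|lt|/val_inj eq]; first exact: hw.
    by apply: (hw y x) => //; rewrite ?[y == x]eq_sym // finset.setUC.
  by rewrite eq eqxx in xy.
exists x, y; split => //; apply: leq_trans te _; apply: subset_leq_card.
apply/fintype.subsetP => v; rewrite !inE ee => /fintype.subsetP sub.
by have := sub x; have := sub y; rewrite !inE !eqxx orbT => -> // -> //.
Qed.

(** A [d]-dimensional box [B] among the points common to levels [x < y], taken at both levels, is a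
    box of dimension [d.+1]: coordinate [ord0] selects the level and the lifted coordinates index
    [B]. *)
Lemma forces_algebraS (d : nat) (T : Type) (V : finType) (phi : V -> set T)
    (t n : nat) :
  forces_algebra d phi t ->
  forces_algebra d.+1 (with_chain (n := n) phi) (#|V| + t * 'C(n, 2)).
Proof.
move=> force S /rich_pair[x [y [xy]]] /force[B [[BI BU] Binj BS]].
pose rest (I : {set 'I_d.+1}) := [set i | lift ord0 i \in I]%SET.
pose B' (I : {set 'I_d.+1}) : set (T + nat) := fun z =>
  match z with inl s => B (rest I) s | inr k => (k < if ord0 \in I then y else x)%N end.
have restI I J : rest (I :&: J)%SET = (rest I :&: rest J)%SET.
  by apply/setP => i; rewrite !inE.
have restU I J : rest (I :|: J)%SET = (rest I :|: rest J)%SET.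
  by apply/setP => i; rewrite !inE.
exists B'; split.
- split=> I J; apply/funext => -[s|k]; apply/propext; rewrite /B' /setI /setU /=.
  + by rewrite restI -BI.
  + by rewrite inE; case: (_ \in I); case: (_ \in J) => /=; lia.
  + by rewrite restU -BU.
  + by rewrite inE; case: (_ \in I); case: (_ \in J) => /=; lia.
- move=> I J eqB; have eq_rest : rest I = rest J.
    by apply: Binj; apply/funext => s; have := congr1 (@^~ (inl s)) eqB.
  apply/setP => i; case: (unliftP ord0 i) => [j|] ->.
    by have /setP/(_ j) := eq_rest; rewrite !inE.
  (* The number [x] lies in the initial segment of length [y] but not in that of length [x], so it
     detects the level. *)
  have : B' I (inr (nat_of_ord x)) <-> B' J (inr (nat_of_ord x)) by rewrite eqB.
  rewrite /B'; case: (_ \in I); case: (_ \in J); rewrite ?ltnn ?xy //.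
    by case=> /(_ isT).
  by case=> _ /(_ isT).
- move=> I; have [v] := BS (rest I); rewrite inE => /andP[xv yv] eqv.
  exists (if ord0 \in I then y else x, v); first by case: ifP.
  by apply/funext => -[s|k] /=; rewrite /B' /with_chain /= ?eqv //; case: ifP.
Qed.

(** Any [m] of the sets [phi v] form a witness family: a subfamily with more than [t] members is the
    image of more than [t] points, which force an algebra. *)
Lemma fmin_le (d m t : nat) (T : Type) (V : finType) (phi : V -> set T) :
  injective phi -> forces_algebra d phi t -> (m <= #|V|)%N ->
  (fmin m (Bfree d) <= t)%N.
Proof.
move=> inj force mV.
have [V' V'm] : exists V' : {set V}, #|V'| = m.
  have : (0 < #|[set A : {set V} | #|A| == m]%SET|)%N by rewrite card_draws bin_gt0.
  by case/card_gt0P => A; rewrite inE => /eqP; exists A.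
pose F : set_family T := [fset phi v | v in V']%fset.
have Fm : #|` F| = m by rewrite card_imfset //= -cardE.
rewrite /fmin; case: ex_minnP => k _ /(_ (largest_sub F (Bfree d))) min_k.
apply: leq_trans (min_k _) _; first by apply/asboolP; exists T, F.
apply/bigmax_leqP_seq => F'; rewrite fpowersetE => subF /asboolP free.
rewrite leqNgt; apply/negP => ltF.
pose S := [set v in V' | phi v \in F']%SET.
have cardS : #|` F'| = #|S|.
  have -> : F' = [fset phi v | v in S]%fset.
    apply/fsetP => X; apply/idP/imfsetP => [XF|[v /=]].
      have /imfsetP[v /= vV eX] := fsubsetP subF _ XF.
      by exists v => //=; rewrite inE vV -eX.
    by rewrite inE => /andP[_ ?] ->.
  by rewrite card_imfset //= -cardE.
have [|B [[BI BU] Binj BS]] := force S; first by rewrite -cardS.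
apply: (free [fset B I | I in {: {set 'I_d}}]%fset).
  apply/fsubsetP => _ /imfsetP[I _ ->]; have [v] := BS I.
  by rewrite inE => /andP[_ ?] ->.
split; first by rewrite card_imfset //= -cardE -cardsT -powersetT card_powerset
  cardsT card_ord.
exists B; split => // X; split => [/imfsetP[I _ ->]|[I ->]]; first by exists I.
by apply/imfsetP; exists I.
Qed.

(** * Recovering a Boolean algebra from few of its members *)

(** The index sets [I] with [x] in [B I] form a prime filter on a finite power set, hence the
    principal filter of an atom. Primeness comes from unions, by splitting off one index at a time;
    a member missing [i] would meet [[set i]] in the empty set. *)
Lemma lattice_hom_point (d : nat) (T : Type) (B : {set 'I_d} -> set T) (x : T) :
  lattice_hom B -> B finset.setT x -> ~ B finset.set0 x ->
  exists i, forall I, B I x <-> i \in I.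
Proof.
move=> [BI BU] BT B0.
have mono (I J : {set 'I_d}) : I \subset J -> B I x -> B J x.
  by move=> /finset.setUidPr <-; rewrite -BU; left.
have [i Bi] : exists i, B [set i]%SET x.
  suff gen n : forall I : {set 'I_d}, #|I| = n -> B I x -> exists i, B [set i]%SET x.
    exact: gen erefl BT.
  elim: n => [|n IHn] I cI BIx; first by move/cards0_eq: cI BIx => ->.
  have [i iI] : exists i, i \in I by apply/card_gt0P; rewrite cI.
  move: BIx; rewrite -(finset.setD1K iI) -BU => -[Bi|]; first by exists i.
  by apply: IHn; rewrite (cardsD1 i I) iI in cI; lia.
exists i => I; split=> [BIx|iI]; last by apply: mono Bi; rewrite finset.sub1set.
apply: contrapT => /negP iI; apply: B0.
suff -> : finset.set0 = (I :&: [set i])%SET by rewrite -BI.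
apply/setP => j; rewrite !inE; apply/esym/negP => /andP[jI /eqP eji].
by rewrite -eji jI in iI.
Qed.

(* The ground set falls into [d + 2] regions: inside the bottom of [B], outside its
   top, and one for each atom [i].  A point of these regions lies in the [j]-th
   chosen member for all [j], for no [j], and for [j \in sig i] respectively. *)
Lemma lattice_hom_eq (d k : nat) (T : Type) (sig : 'I_d -> {set 'I_k})
    (B B' : {set 'I_d} -> set T) :
  (0 < k)%N ->
  injective sig -> (forall i, sig i != finset.set0) -> (forall i, sig i != finset.setT) ->
  lattice_hom B -> lattice_hom B' ->
  (forall j, B [set i | j \in sig i]%SET = B' [set i | j \in sig i]%SET) ->
  B = B'.
Proof.
move=> k0 sig_inj sig0 sigT homB homB' eqB.
have pattern (C : {set 'I_d} -> set T) x : lattice_hom C ->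
    exists s : {set 'I_k}, (forall j, C [set i | j \in sig i]%SET x <-> j \in s) /\
      [\/ s = finset.setT /\ forall I, C I x, s = finset.set0 /\ forall I, ~ C I x
        | exists i, s = sig i /\ forall I, C I x <-> i \in I].
  move=> homC; have [CI CU] := homC.
  have mono (I J : {set 'I_d}) : I \subset J -> C I x -> C J x.
    by move=> /finset.setUidPr <-; rewrite -CU; left.
  have [C0|C0] := pselect (C finset.set0 x).
    have all I : C I x by apply: mono C0; rewrite finset.sub0set.
    by exists finset.setT; split=> [j|]; [rewrite inE|apply: Or31].
  have [CT|CT] := pselect (C finset.setT x); last first.
    have none I : ~ C I x.
      by move=> /(mono _ finset.setT); rewrite finset.subsetT => /(_ isT).
    by exists finset.set0; split=> [j|]; [rewrite inE; split=> // /none|apply: Or32].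
  have [i iC] := lattice_hom_point homC CT C0.
  by exists (sig i); split=> [j|]; [rewrite iC inE|apply: Or33; exists i].
apply/funext => I; apply/funext => x; apply/propext.
have [s [sB caseB]] := pattern B x homB.
have [s' [sB' caseB']] := pattern B' x homB'.
(* Agreement on the chosen members gives [x] the same pattern for [B] and [B']. Distinct regions
   have distinct patterns, so the mixed cases below are contradictory. *)
have es : s' = s.
  apply/setP => j; apply/idP/idP => [/sB'|/sB]; first by rewrite -eqB => /sB.
  by rewrite eqB => /sB'.
rewrite {s'}es in sB' caseB' *.
have neqT0 : finset.setT <> finset.set0 :> {set 'I_k}.
  by move/setP/(_ (Ordinal k0)); rewrite !inE.
case: caseB => [[es inI]|[es inI]|[i [es inI]]];
  case: caseB' => [[es' inI']|[es' inI']|[i' [es' inI']]].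
- by split.
- by case: neqT0; rewrite -es.
- by move: (sigT i'); rewrite -es' es eqxx.
- by case: neqT0; rewrite -es'.
- by split=> [/inI|/inI'].
- by move: (sig0 i'); rewrite -es' es eqxx.
- by move: (sigT i); rewrite -es es' eqxx.
- by move: (sig0 i); rewrite -es es' eqxx.
- by rewrite inI inI' (sig_inj i i') // -es.
Qed.

(** Of the [2 ^ k] subsets of ['I_k], discarding the empty and the full one leaves at least [d]. *)
Lemma separating_patterns (d k : nat) : (d + 2 <= 2 ^ k)%N -> (0 < k)%N ->
  exists sig : 'I_d -> {set 'I_k},
    [/\ injective sig, forall i, sig i != finset.set0 & forall i, sig i != finset.setT].
Proof.
move=> dk k0; pose P := [set s : {set 'I_k} | (s != finset.set0) && (s != finset.setT)]%SET.
have cardP : (d <= #|P|)%N.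
  have : (#|~: P| <= 2)%N.
    apply: leq_trans (_ : (#|[set finset.set0; finset.setT : {set 'I_k}]%SET| <= 2)%N).
      apply: subset_leq_card; apply/fintype.subsetP => s.
      by rewrite !inE negb_and !negbK.
    by rewrite cards2; case: eqP.
  have := cardsC P; rewrite -cardsT -powersetT card_powerset cardsT card_ord; lia.
have nthP (i : 'I_d) : nth finset.set0 (enum P) i \in P.
  by rewrite -mem_enum mem_nth // -cardE (leq_trans (ltn_ord i)).
exists (fun i => nth finset.set0 (enum P) i); split=> [i j /eqP|i|i].
- rewrite nth_uniq ?enum_uniq -?cardE ?(leq_trans (ltn_ord _)) // => /eqP.
  exact: val_inj.
- by have := nthP i; rewrite inE => /andP[].
- by have := nthP i; rewrite inE => /andP[].
Qed.

(** * Counting the Boolean algebras in a family *)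

(** Algebras are taken as sets over the finite type [F], to serve as the edges in
    [deletion_method]. *)
Definition algebras (d : nat) (T : Type) (F : set_family T) : {set {set F}} :=
  [set e : {set F} | `[< boolean_algebra d [fset val v | v in e]%fset >]]%SET.

Lemma algebrasP (d : nat) (T : Type) (F : set_family T) (e : {set F}) :
  e \in algebras d F -> exists B : {set 'I_d} -> set T,
    [/\ lattice_hom B, injective B, (forall I, exists2 v, v \in e & B I = val v)
      & forall v : F, v \in e -> exists I, val v = B I].
Proof.
rewrite inE => /asboolP[cardA [B [AB BI BU]]]; exists B; split => //.
- move=> I J eIJ; apply: contrapT => /eqP neIJ.
  suff : (2 ^ d <= #|[set~ J]%SET|)%N.
    rewrite cardsC1 -cardsT -powersetT card_powerset cardsT card_ord.
    by have := expn_gt0 2 d; lia.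
  rewrite -cardA; set A := [fset val v | v in e]%fset in cardA AB *.
  apply: (@leq_trans #|` [fset B K | K in [set~ J]%SET]%fset|); last first.
    by apply: leq_trans (leq_imfset_card _ _ _) _; rewrite /= -cardE.
  apply: fsubset_leq_card; apply/fsubsetP => X /AB[K ->]; apply/imfsetP => /=.
  have [->|neKJ] := eqVneq K J; last by exists K; rewrite // !inE.
  by exists I; rewrite // !inE.
- move=> I; have /AB/imfsetP[v /= ve ->] : exists J, B I = B J by exists I.
  by exists v.
- by move=> v ve; apply/AB/imfsetP; exists v.
Qed.

Lemma card_algebras (d : nat) (T : Type) (F : set_family T) (e : {set F}) :
  e \in algebras d F -> #|e| = (2 ^ d)%N.
Proof.
rewrite inE => /asboolP[<- _]; rewrite card_imfset //=; last exact: val_inj.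
by rewrite -cardE.
Qed.

(** Counting by codes that are only known to exist: choice turns the relation into a function
    injective on [E]. *)
Lemma card_le_code (X Y : finType) (E : {set X}) (D : {set Y})
    (rel : X -> Y -> Prop) :
  (forall e, e \in E -> exists2 y, y \in D & rel e y) ->
  (forall e e' y, e \in E -> e' \in E -> rel e y -> rel e' y -> e = e') ->
  (#|E| <= #|D|)%N.
Proof.
move=> code inj.
have [->|[x0 x0E]] := set_0Vmem E; first by rewrite cards0.
have [y0 _ _] := code x0 x0E.
have /choice[f fP] : forall e, exists y, e \in E -> y \in D /\ rel e y.
  move=> e; have [eE|eE] := boolP (e \in E); last by exists y0.
  by have [y yD ey] := code e eE; exists y.
have finj : {in E &, injective f}.
  move=> e e' eE e'E ef; have [_ re] := fP e eE; have [_ re'] := fP e' e'E.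
  by apply: inj re _ => //; rewrite ef.
rewrite -(card_in_imset finj); apply: subset_leq_card.
by apply/fintype.subsetP => _ /imsetP[e eE ->]; have [] := fP e eE.
Qed.

(** The code of an algebra is the [k]-tuple of its members at the indices [[set i | j \in sig i]];
    [lattice_hom_eq] recovers [B] from it. *)
Lemma algebras_le (d k : nat) (T : Type) (F : set_family T) :
  (d + 2 <= 2 ^ k)%N -> (0 < k)%N -> (#|algebras d F| <= #|` F| ^ k)%N.
Proof.
move=> dk k0; have [sig [sig_inj sig0 sigT]] := separating_patterns dk k0.
suff : (#|algebras d F| <= #|[set: {ffun 'I_k -> F}]%SET|)%N.
  by rewrite cardsT card_ffun card_ord cardfE.
pose code (e : {set F}) (h : {ffun 'I_k -> F}) := exists B : {set 'I_d} -> set T,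
  [/\ lattice_hom B, forall v, v \in e <-> exists I, val v = B I
    & forall j, B [set i | j \in sig i]%SET = val (h j)].
apply: (card_le_code (rel := code)) => [e|e e' h _ _].
  case/algebrasP => B [homB _ BE EB].
  have /choice[h hP] : forall j,
      exists v : F, B [set i | j \in sig i]%SET = val v.
    by move=> j; have [v _ ev] := BE [set i | j \in sig i]%SET; exists v.
  exists [ffun j => h j]; first by rewrite inE.
  exists B; split=> // [v|j]; last by rewrite ffunE.
  split=> [/EB//|[I vI]]; have [u ue uI] := BE I.
  by rewrite (_ : v = u) //; apply: val_inj; rewrite vI.
move=> [B [homB eB Bh]] [B' [homB' eB' Bh']].
have eqB : B = B'.
  by apply: lattice_hom_eq k0 sig_inj sig0 sigT homB homB' _ => j; rewrite Bh Bh'.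
apply/setP => v; apply/idP/idP => [/eB|/eB'] h'; [apply/eB'|apply/eB];
  by rewrite ?eqB // -eqB.
Qed.

Lemma algebras2_le (T : Type) (F : set_family T) :
  (#|algebras 2 F| <= 'C(#|` F|, 2))%N.
Proof.
have -> : #|` F| = #|{: F}| by rewrite cardfE.
rewrite -card_draws.
(* A dimension 2 algebra is determined by its unordered pair of incomparable
   members; ordered pairs would cost the constant a factor [2 ^ (1 / 3)]. *)
pose code (e P : {set F}) := exists X Y : F, P = [set X; Y]%SET /\
  forall v, v \in e <-> [\/ v = X, v = Y, val v = val X `&` val Y | val v = val X `|` val Y].
apply: (card_le_code (rel := code)) => [e|e e' P _ _].
  case/algebrasP => B [[BI BU] Binj BE EB].
  have [X Xe eX] := BE [set ord0]%SET; have [Y Ye eY] := BE [set ord_max]%SET.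
  exists [set X; Y]%SET.
    rewrite inE cards2; have [eXY|//] := eqVneq X Y.
    have /Binj/setP/(_ ord0) : B [set ord0]%SET = B [set ord_max]%SET by rewrite eX eY eXY.
    by rewrite !inE.
  exists X, Y; split => // v.
  have mem_e I w : val w = B I -> w \in e.
    move=> wI; have [u ue uI] := BE I; rewrite (_ : w = u) //.
    by apply: val_inj; rewrite wI.
  rewrite -eX -eY BI BU; split=> [/EB[I vI]|[->//|->//|/mem_e//|/mem_e//]].
  (* The four subsets of ['I_2] give, in order, the union, [X], [Y] and the intersection. *)
  have [I0|I0] := boolP (ord0 \in I); have [I1|I1] := boolP (ord_max \in I).
  - apply: Or44; rewrite vI;
      congr B; apply/setP => -[[|[|//]] lt2]; rewrite !inE.
    + by rewrite (_ : Ordinal lt2 = ord0) ?I0 //; apply: val_inj.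
    + by rewrite (_ : Ordinal lt2 = ord_max) ?I1 ?orbT //; apply: val_inj.
  - apply: Or41; apply: val_inj; rewrite vI -eX;
      congr B; apply/setP => -[[|[|//]] lt2]; rewrite !inE.
    + by rewrite (_ : Ordinal lt2 = ord0) ?I0 //; apply: val_inj.
    + by rewrite (_ : Ordinal lt2 = ord_max) ?(negbTE I1) //; apply: val_inj.
  - apply: Or42; apply: val_inj; rewrite vI -eY;
      congr B; apply/setP => -[[|[|//]] lt2]; rewrite !inE.
    + by rewrite (_ : Ordinal lt2 = ord0) ?(negbTE I0) //; apply: val_inj.
    + by rewrite (_ : Ordinal lt2 = ord_max) ?I1 //; apply: val_inj.
  - apply: Or43; rewrite vI;
      congr B; apply/setP => -[[|[|//]] lt2]; rewrite !inE.
    + by rewrite (_ : Ordinal lt2 = ord0) ?(negbTE I0) //; apply: val_inj.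
    + by rewrite (_ : Ordinal lt2 = ord_max) ?(negbTE I1) //; apply: val_inj.
move=> [X [Y [-> eXY]]] [X' [Y' [eP eXY']]].
(* The pair fixes [X] and [Y] only up to exchange, under which the description of [e] is
   symmetric. *)
have swap : (X = X' /\ Y = Y') \/ (X = Y' /\ Y = X').
  have : X \in [set X'; Y']%SET by rewrite -eP set21.
  have : Y \in [set X'; Y']%SET by rewrite -eP set22.
  have : X' \in [set X; Y]%SET by rewrite eP set21.
  have : Y' \in [set X; Y]%SET by rewrite eP set22.
  rewrite !inE => /orP[]/eqP h1 /orP[]/eqP h2 /orP[]/eqP h3 /orP[]/eqP h4;
    first [by left; split; congruence|by right; split; congruence].
apply/setP => v; apply/idP/idP => [/eXY|/eXY'] h; [apply/eXY'|apply/eXY].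
  case: swap h => -[-> ->] // [] h; [exact: Or42|exact: Or41| |].
    by apply: Or43; rewrite setIC.
  by apply: Or44; rewrite setUC.
case: swap h => -[-> ->] // [] h; [exact: Or42|exact: Or41| |].
  by apply: Or43; rewrite setIC.
by apply: Or44; rewrite setUC.
Qed.

(** * Bounds on [fmin] from counting and from grids *)

(** [deletion_method] applied to the hypergraph of algebras, which is uniform with edge size
    [2 ^ d]: an algebra left in the subfamily would be an edge inside [S]. *)
Lemma fmin_ge (R : realType) (d m N : nat) (p : R) : 0 <= p -> p <= 1 ->
  (forall (T : Type) (F : set_family T), #|` F| = m -> (#|algebras d F| <= N)%N) ->
  p * m%:R - p ^+ (2 ^ d) * N%:R <= (fmin m (Bfree d))%:R.
Proof.
move=> p0 p1 le_N; rewrite /fmin; case: ex_minnP => k /asboolP[T [F [Fm <-]]] _.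
have [|S bigS freeS] := deletion_method _ (@card_algebras d T F) p0 p1.
  by rewrite expn_gt0.
pose F' := [fset val v | v in S]%fset.
have card_imS (e : {set F}) : #|` [fset val v | v in e]%fset| = #|e|.
  by rewrite card_imfset //= -?cardE //; exact: val_inj.
have free : Bfree d F'.
  move=> A subA algA.
  pose e := [set v in S | val v \in A]%SET.
  have eA : [fset val v | v in e]%fset = A.
    apply/fsetP => X; apply/imfsetP/idP => [[v /=]|XA].
      by rewrite inE => /andP[_ ?] ->.
    have /imfsetP[v /= vS eX] := fsubsetP subA X XA.
    by exists v => //=; rewrite inE vS /= -eX.
  have /freeS/negP[] : e \in algebras d F by rewrite inE eA; apply/asboolP.
  by apply/fintype.subsetP => v; rewrite inE => /andP[].
apply: (@le_trans _ _ #|S|%:R).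
  apply: le_trans bigS; rewrite -cardfE Fm lerD2l lerN2 ler_wpM2l ?exprn_ge0 //.
  by rewrite ler_nat le_N.
rewrite ler_nat -card_imS /largest_sub.
apply: (@leq_bigmax_seq _ _ (fun F' => `[< Bfree d F' >])); last exact/asboolP.
rewrite fpowersetE; apply/fsubsetP => _ /imfsetP[v _ ->]; exact: valP.
Qed.

(* The grid is the product of chains of lengths [n, n^2, n^4, ...]; its sides are
   squared at each step because the pigeonhole over pairs squares the density
   lost. *)
Lemma unbalanced_grid (d n : nat) :
  exists (T : Type) (V : finType) (phi : V -> set T) (t : nat),
    [/\ injective phi, #|V| = (n ^ (2 ^ d).-1)%N, (t * n <= 2 * n ^ (2 ^ d).-1)%N
      & forces_algebra d phi t].
Proof.
elim: d n => [|d IHd] n.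
  exists unit, unit, (fun=> set0), 0%N; split => //.
  - by move=> [] [].
  - by rewrite card_unit.
  - exact: forces_algebra0.
have [T [V [phi [t [inj cardV tV force]]]]] := IHd (n ^ 2)%N.
have eN : ((2 ^ d.+1).-1 = (2 * (2 ^ d).-1).+1)%N.
  by rewrite expnS; have := expn_gt0 2 d; lia.
exists (T + nat)%type, ('I_n * V)%type, (with_chain phi), (#|V| + t * 'C(n, 2))%N; split.
- exact: with_chain_inj.
- by rewrite card_prod card_ord cardV -expnM eN expnS.
- rewrite eN expnS mulnCA [leqLHS]mulnC expnM leq_mul2l; apply/orP; right.
  (* By induction [t * n ^ 2 <= 2 * #|V|], so the pairs contribute at most [#|V|] and the new
     threshold is at most [2 * #|V|]; the factor 2 does not grow with [d]. *)
  have : ('C(n, 2) * 2 <= n ^ 2)%N by rewrite bin2; nia.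
  by rewrite -cardV in tV *; nia.
- exact: forces_algebraS.
Qed.

(** A chain of length [b] has threshold 1, so its product with a chain of length [a] has threshold
    [b + 'C(a, 2)]. Keeping both sides free permits the sharp choice behind the constant [3 / 2]. *)
Lemma fmin2_le (m a b : nat) : (m <= a * b)%N ->
  (fmin m (Bfree 2) <= b + 'C(a, 2))%N.
Proof.
move=> mab; pose phi0 := fun _ : unit => @set0 unit.
have inj0 : injective phi0 by move=> [] [].
have := forces_algebraS (n := a) (forces_algebraS (n := b) (forces_algebra0 phi0)).
rewrite card_prod card_unit card_ord !muln1 addn0 mul1n.
move/(fmin_le (with_chain_inj (with_chain_inj inj0))); apply.
by rewrite !card_prod card_unit !card_ord muln1.
Qed.

(** * Choice of parameters over the reals *)

(** Writing [m] as [x ^+ N] turns the real powers of [m] into integer powers of [x], so the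
    estimates become polynomial. *)
Lemma root_exists (R : realType) (m N : nat) : (0 < m)%N -> (0 < N)%N ->
  exists x : R, [/\ 1 <= x, x ^+ N = m%:R
    & forall j : nat, (m%:R : R) `^ (j%:R / N%:R) = x ^+ j].
Proof.
move=> m0 N0; exists ((m%:R : R) `^ N%:R^-1).
have N0' : (N%:R : R) != 0 by rewrite pnatr_eq0 -lt0n.
split.
- by rewrite -[leLHS](powRr0 m%:R) ler_powR ?invr_ge0 ?ler1n.
- by rewrite -powR_mulrn ?powR_ge0 // -powRrM mulVf // powRr1.
- by move=> j; rewrite -powR_mulrn ?powR_ge0 // -powRrM mulrC.
Qed.

(** With [n] the integer just above [x], the grid has at least [m] points and threshold at most
    [2 * n ^ N.-1]. Since [n <= 2 * x], this is at most [2 ^+ N * x ^+ N.-1]. *)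
Lemma fmin_upper (R : realType) (d m : nat) : (2 <= d)%N -> (0 < m)%N ->
  ((fmin m (Bfree d))%:R : R) <= 2 ^+ (2 ^ d).-1 * (m%:R : R) `^ e_up R d.
Proof.
move=> d2 m0; set N := (2 ^ d).-1.
have N1 : (1 < N)%N.
  have : (4 <= 2 ^ d)%N by exact: (@leq_pexp2l 2 2 d).
  by rewrite /N; lia.
have [x [x1 xN powx]] := root_exists R m0 (ltnW N1).
have -> : e_up R d = N.-1%:R / N%:R.
  have e2 : (2 : R) ^+ d = N%:R + 1.
    by rewrite -natrX natr1 /N prednK // expn_gt0.
  by rewrite /e_up e2 addrK -subn1 natrB ?(ltnW N1) //; congr (_ / _); ring.
rewrite powx; pose n := (Num.trunc x).+1.
have /andP[nl nu] : ((Num.trunc x)%:R <= x < n%:R) by apply: truncn_itv; lra.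
have [T [V [phi [t [inj cardV tn force]]]]] := unbalanced_grid d n.
have mV : (m <= #|V|)%N.
  by rewrite cardV -(ler_nat R) natrX -xN lerXn2r ?nnegrE ?ltW //; lra.
have t_le : (t <= 2 * n ^ N.-1)%N.
  have eN : (n ^ N = n ^ N.-1 * n)%N by rewrite -expnSr prednK // ltnW.
  by rewrite -/N eN mulnA leq_mul2r in tn.
apply: (@le_trans _ _ (2 * n ^ N.-1)%:R).
  by rewrite ler_nat (leq_trans (fmin_le inj force mV)).
rewrite natrM natrX -[N in X in _ <= X]prednK ?(ltnW N1) // exprS -mulrA -exprMn.
rewrite ler_pM2l // lerXn2r ?nnegrE //; first lra.
by rewrite /n -natr1; lra.
Qed.

Lemma fmin2_upper (R : realType) (m : nat) : (0 < m)%N ->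
  ((fmin m (Bfree 2))%:R : R) <= 3 / 2 * (m%:R : R) `^ (2 / 3).
Proof.
move=> m0; have [x [x1 x3 ->]] := root_exists R m0 (isT : (0 < 3)%N).
(* [m / a + a ^ 2 / 2] is least at the cube root of [m], so [a] is [x] rounded to the nearest
   integer, and [b] below is [m / a] rounded up. *)
pose a := Num.trunc (x + 1 / 2).
have /andP[al au] : (a%:R <= x + 1 / 2 < a.+1%:R) by apply: truncn_itv; lra.
have a1 : (0 < a)%N by rewrite -(ltr_nat R) -[ltRHS](addrK 1) natr1; lra.
pose b := ((m + a).-1 %/ a)%N.
have mab : (m <= a * b)%N.
  by rewrite /b; have := divn_eq (m + a).-1 a; have := ltn_pmod (m + a).-1 a1; nia.
have bl : (a * b <= (m + a).-1)%N by rewrite mulnC leq_trunc_div.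
have bl' : (a%:R * b%:R : R) <= m%:R + a%:R - 1.
  rewrite -natrM -natrD -(@natrB R _ 1) ?ler_nat; lia.
apply: (@le_trans _ _ (b + 'C(a, 2))%:R); first by rewrite ler_nat fmin2_le.
have binE : ('C(a, 2)%:R : R) = a%:R * (a%:R - 1) / 2.
  have : ((2 * 'C(a, 2))%:R : R) = a%:R * (a%:R - 1).
    by rewrite -mul_bin_diag bin1 natrM -subn1 natrB.
  rewrite natrM; lra.
rewrite natrD binE; rewrite -x3 in bl'.
have a1' : 1 <= (a%:R : R) by rewrite ler1n.
(* An integer other than 1 is at least 7/4. *)
have a47 : 0 <= (4 * (a%:R : R) - 7) * (a%:R - 1).
  have [->|a2] := eqVneq a 1%N; first by rewrite subrr mulr0.
  have : 2 <= (a%:R : R) by rewrite (ler_nat R 2); lia.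
  by move=> ?; rewrite mulr_ge0; lra.
rewrite -[a.+1%:R]natr1 in au; move: (a%:R : R) (b%:R : R) al au bl' a1' a47 => A B al au bl' a1' a47.
have A0 : 0 < A by lra.
rewrite -(ler_pM2l A0).
(* This is the claim times [A], by [x^3 + A^3 / 2 - 3 A x^2 / 2 = (A - x)^2 (A + 2 x) / 2]. Rounding
   gives [(A - x)^2 <= 1 / 4] and [x < A + 1 / 2], which leave [- (4 A - 7) (A - 1) / 8] as an upper
   bound. *)
suff key : (A - x) ^+ 2 * (A + 2 * x) / 2 + A - 1 - A ^+ 2 / 2 <= 0 by nra.
have near : 0 <= (x + 1 / 2 - A) * (A + 1 / 2 - x) by rewrite mulr_ge0; lra.
have pos : 0 <= A + 2 * x by lra.
by have := mulr_ge0 near pos; nra.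
Qed.

Lemma fmin2_lower (R : realType) (m : nat) : (0 < m)%N ->
  3 * (2 : R) `^ (- (7 / 3)) * (m%:R : R) `^ (2 / 3) <= (fmin m (Bfree 2))%:R.
Proof.
move=> m0; have [x [x1 x3 ->]] := root_exists R m0 (isT : (0 < 3)%N).
have [y [y1 y3 powy]] := root_exists R (isT : (0 < 2)%N) (isT : (0 < 3)%N).
have -> : (2 : R) `^ (- (7 / 3)) = (y ^+ 7)^-1 by rewrite powRN powy.
have y0 : y != 0 by lra.
have x0 : x != 0 by lra.
(* The maximiser of [p * m - p ^ 4 * m ^ 2 / 2], namely the solution of [2 * m * p ^ 3 = 1]. *)
pose p := (x * y)^-1.
have xy1 : 1 <= x * y by nra.
have p0 : 0 <= p by rewrite invr_ge0; lra.
have p1 : p <= 1 by rewrite invf_le1; lra.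
have leE T (F : set_family T) : #|` F| = m -> (#|algebras 2 F| <= 'C(m, 2))%N.
  by move=> <-; exact: algebras2_le.
apply: le_trans (fmin_ge p0 p1 leE).
have binE : ('C(m, 2)%:R : R) <= m%:R ^+ 2 / 2.
  rewrite ler_pdivlMr // -natrM -natrX ler_nat bin2; nia.
apply: (@le_trans _ _ (p * m%:R - p ^+ 4 * (m%:R ^+ 2 / 2))); last first.
  by rewrite lerD2l lerN2 ler_wpM2l ?exprn_ge0.
suff -> : p * m%:R - p ^+ 4 * (m%:R ^+ 2 / 2) = 3 * (y ^+ 7)^-1 * x ^+ 2 by [].
have y3' : y ^+ 3 = 2 by rewrite y3.
have -> : y ^+ 7 = 4 * y by rewrite (exprD _ 4 3) (exprD _ 1 3) y3'; ring.
have p4 : p ^+ 4 = (2 * x ^+ 4 * y)^-1.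
  by rewrite /p exprVn exprMn (exprD y 3 1) y3'; congr (_^-1); ring.
rewrite p4 -x3 /p; field.
by rewrite x0 y0.
Qed.

Lemma fmin_lower (R : realType) (d m : nat) : (2 <= d)%N -> (0 < m)%N ->
  1 / 4 * (m%:R : R) `^ e_low R d <= (fmin m (Bfree d))%:R.
Proof.
move=> d2 m0; pose k := `|Num.ceil (log2 (d%:R + 2 : R))|%N.
have log2_gt0 : 0 < log2 (d%:R + 2 : R).
  have d0 : 0 <= d%:R :> R by [].
  by rewrite divr_gt0 // ln_gt0 //; lra.
have kE : Num.ceil (log2 (d%:R + 2 : R)) = k.
  by rewrite /k gez0_abs // ltW // ceil_gt0.
have k0 : (0 < k)%N by rewrite absz_gt0 gt_eqF // ceil_gt0.
have dk : (d + 2 <= 2 ^ k)%N.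
  rewrite -(ler_nat R) natrD natrX -ler_ln ?posrE ?exprn_gt0 ?ltr_wpDl // lnXn //.
  have := ceil_ge (log2 (d%:R + 2 : R)); rewrite kE /log2 ler_pdivrMr ?ln_gt0 ?ltr1n //.
  by rewrite mulr_natl.
set N := (2 ^ d).-1.
have eN : (2 ^ d = N.+1)%N by rewrite /N prednK // expn_gt0.
have N1 : (1 < N)%N.
  have : (4 <= 2 ^ d)%N by exact: (@leq_pexp2l 2 2 d).
  by rewrite /N; lia.
clearbody k N.
have [x [x1 xN powx]] := root_exists R m0 (ltnW N1).
have x0 : 0 < x by lra.
have -> : (m%:R : R) `^ e_low R d = x ^+ N / x ^+ k.-1.
  have e2 : (2 : R) ^+ d = N%:R + 1 by rewrite -natrX eN -natr1.
  have N0 : N%:R != 0 :> R by rewrite pnatr_eq0; lia.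
  have -> : e_low R d = 1 - k.-1%:R / N%:R.
    by rewrite /e_low kE e2 addrK -subn1 natrB //; field.
  by rewrite powRD ?powRN ?powx ?powRr1 ?xN // pnatr_eq0 -lt0n m0 implybT.
(* This balances the two terms: both become multiples of [x ^+ N / x ^+ k.-1], with factors [1 / 2]
   and [2 ^ - (N + 1) <= 1 / 4]. The difference leaves the constant [1 / 4]. *)
pose p := (2 * x ^+ k.-1)^-1.
have xk1 : 1 <= x ^+ k.-1 by rewrite exprn_ege1.
have p0 : 0 <= p by rewrite invr_ge0 mulr_ge0 // exprn_ge0 // ltW.
have p1 : p <= 1.
  by rewrite invf_le1 ?mulr_ege1 ?ler1n // mulr_gt0 // exprn_gt0.
have leE T (F : set_family T) : #|` F| = m -> (#|algebras d F| <= m ^ k)%N.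
  by move=> <-; exact: algebras_le.
apply: le_trans (fmin_ge p0 p1 leE).
have -> : p ^+ (2 ^ d) * (m ^ k)%:R = (2 ^+ N.+1)^-1 * (x ^+ N / x ^+ k.-1).
  have t0 i : x ^+ i != 0 by rewrite expf_neq0 // gt_eqF.
  have -> : (m ^ k)%:R = x ^+ N * (x ^+ k.-1) ^+ N.
    by rewrite natrX -xN -[in LHS](prednK k0) exprS -!exprM mulnC.
  rewrite eN /p exprVn exprMn invfM -mulrA [(x ^+ k.-1) ^+ N.+1]exprS.
  congr (_ * _); move: (t0 k.-1) (t0 (k.-1 * N)%N); rewrite exprM.
  by move: (x ^+ k.-1) => t; move: (t ^+ N) => u tn un; field; rewrite tn un.
have -> : p * m%:R = 1 / 2 * (x ^+ N / x ^+ k.-1).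
  by rewrite -xN /p invfM; ring.
rewrite -mulrBl ler_wpM2r //; first by rewrite divr_ge0 // exprn_ge0 // ltW.
have : (2 ^+ N.+1)^-1 <= (2 ^+ 2)^-1 :> R.
  by rewrite lef_pV2 ?posrE ?exprn_gt0 // ler_eXn2l ?ltr1n //; lia.
move: (2 ^+ N.+1)^-1 => q; rewrite expr2; lra.
Qed.

Theorem theorem1p1 (R : realType) :
  (forall d : nat, (2 <= d)%N ->
     exists c c' : R, [/\ 0 < c, 0 < c' &
       forall m : nat, (0 < m)%N ->
         c * (m%:R : R) `^ e_low R d <= (fmin m (Bfree d))%:R <= c' * (m%:R : R) `^ e_up R d])
  /\
  (exists o : nat -> R, o @ \oo --> (0 : R) /\
     forall m : nat, (0 < m)%N ->
       (3 * (2 : R) `^ (- (7 / 3)) + o m) * (m%:R : R) `^ (2 / 3) <= (fmin m (Bfree 2))%:R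
         <= 3 / 2 * (m%:R : R) `^ (2 / 3)).
Proof.
split=> [d d2|].
  exists (1 / 4), (2 ^+ (2 ^ d).-1); split=> [||m m0]; first lra.
    by rewrite exprn_gt0.
  by rewrite fmin_lower // fmin_upper.
(* The lower bound holds for every positive [m] without an error term. *)
exists (fun=> 0); split=> [|m m0]; first exact: cvg_cst.
by rewrite addr0 fmin2_lower // fmin2_upper.
Qed.
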